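(* Let $n$ be a fixed odd number, $0\le k\le m$ and $s\ge0$ be integers. Then $$\overline{\partial}\left[\mathcal{A}_{k,s}^n(x)\right]=k\,\mathcal{A}_{k-1,s}^n(x)+2s\,\mathcal{A}_{k,s-1}^n(x),$$ where $\mathcal{A}_{k,s}^n(x):=x_0^kP_s^n(x)$ (a term with coefficient $k=0$ or $s=0$ being zero).
   Context: $\mathbb{R}_n$ is the real Clifford algebra generated by $e_1,\dots,e_n$ with $e_\ell e_m+e_me_\ell=0$ for $\ell\ne m$ and $e_\ell^2=-1$. A point $(x_0,\dots,x_n)\in\mathbb{R}^{n+1}$ is identified with the paravector $x=x_0+\underline{x}$, $\underline{x}=\sum_{\ell=1}^n x_\ell e_\ell$; $\bar x=x_0-\underline{x}$. $\overline{\partial}=\partial_{x_0}-\sum_{\ell=1}^n e_\ell\partial_{x_\ell}$, acting from the left. The Clifford-Appell polynomials are $$P_k^n(x):=\sum_{s=0}^k T_s^k(n)\,x^{k-s}\bar x^{s},\qquad T_s^k(n):=\binom{k}{s}\frac{\left(\frac{n+1}{2}\right)_{k-s}\left(\frac{n-1}{2}\right)_s}{(n)_k},$$ where $(a)_0=1$ and $(a)_s=a(a+1)\cdots(a+s-1)$ for $s>0$. *)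

(* Defs.v *)
From HB Require Import structures.
From mathcomp Require Import all_boot all_order all_algebra.
From mathcomp Require Import all_classical all_reals all_analysis.

Set Implicit Arguments.
Unset Strict Implicit.
Unset Printing Implicit Defensive.

Import Order.TTheory GRing.Theory Num.Theory.
Import numFieldNormedType.Exports.

Local Open Scope ring_scope.

Definition symdiff (T : finType) (A B : {set T}) : {set T} :=
  [set i | (i \in A) (+) (i \in B)].

(* Parity of the number of pairs (i, j) in A x B with j <= i: sorting the word
   e_A e_B costs one sign for each pair with j < i (anticommutation) and one
   for each pair with j = i (since e_i ^ 2 = -1). *)
Definition clsign (n : nat) (A B : {set 'I_n}) : bool :=
  \big[addb/false]_(i in A) \big[addb/false]_(j in B) (j <= i)%N.

(* The Clifford algebra generated by n anticommuting square roots of -1,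
   in coordinates over the basis (e_A), A ranging over the subsets of the index
   set, where e_A is the product of the e_i, i \in A, in increasing order. *)
Definition clifford (R : realType) (n : nat) : Type := {ffun {set 'I_n} -> R}.

HB.instance Definition _ (R : realType) (n : nat) :=
  GRing.Lmodule.copy (clifford R n) {ffun {set 'I_n} -> R^o}.

Section CliffordAlgebra.
Variables (R : realType) (n : nat).
Implicit Types (a b c : clifford R n) (A B C : {set 'I_n}).

Definition clbasis A : clifford R n := [ffun B => (B == A)%:R].

Definition clid : clifford R n := clbasis finset.set0.

Definition clmul a b : clifford R n :=
  \sum_A \sum_B ((-1) ^+ clsign A B * a A * b B) *: clbasis (symdiff A B).

Lemma symdiffA : associative (@symdiff 'I_n).
Proof. by move=> A B C; apply/finset.setP=> i; rewrite !inE addbA. Qed.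

Lemma symdiff0s : left_id finset.set0 (@symdiff 'I_n).
Proof. by move=> A; apply/finset.setP=> i; rewrite !inE. Qed.

Lemma symdiffs0 : right_id finset.set0 (@symdiff 'I_n).
Proof. by move=> A; apply/finset.setP=> i; rewrite !inE addbF. Qed.

Lemma big_addb_symdiff A B (F : 'I_n -> bool) :
  \big[addb/false]_(i in symdiff A B) F i =
  \big[addb/false]_(i in A) F i (+) \big[addb/false]_(i in B) F i.
Proof.
rewrite big_mkcond [in RHS]big_mkcond [X in _ (+) X]big_mkcond -big_split /=.
by apply: eq_bigr => i _; rewrite !inE; case: (i \in A) (i \in B) (F i) => [] [] [].
Qed.

Lemma clsignDl A B C : clsign (symdiff A B) C = clsign A C (+) clsign B C.
Proof. exact: big_addb_symdiff. Qed.

Lemma clsignDr A B C : clsign A (symdiff B C) = clsign A B (+) clsign A C.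
Proof.
by rewrite -big_split; apply: eq_bigr => i _; rewrite big_addb_symdiff.
Qed.

Lemma clsign0s A : clsign finset.set0 A = false.
Proof. by rewrite /clsign big_set0. Qed.

Lemma clsigns0 A : clsign A finset.set0 = false.
Proof. by rewrite /clsign big1// => i _; rewrite big_set0. Qed.

Lemma clbasisE a : a = \sum_A a A *: clbasis A.
Proof.
apply/ffunP => B; rewrite sum_ffunE (bigD1 B)//= big1 => [|A /negPf neqAB].
  by rewrite addr0 !ffunE eqxx /GRing.scale/= mulr1.
by rewrite !ffunE eq_sym neqAB /GRing.scale/= mulr0.
Qed.

Lemma clmulDl : left_distributive clmul +%R.
Proof.
move=> a b c; rewrite /clmul -big_split; apply: eq_bigr => A _ /=.
by rewrite -big_split; apply: eq_bigr => B _; rewrite !ffunE mulrDr mulrDl scalerDl.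
Qed.

Lemma clmulDr : right_distributive clmul +%R.
Proof.
move=> a b c; rewrite /clmul -big_split; apply: eq_bigr => A _ /=.
by rewrite -big_split; apply: eq_bigr => B _; rewrite !ffunE mulrDr scalerDl.
Qed.

Lemma clmulZl (k : R) a b : clmul (k *: a) b = k *: clmul a b.
Proof.
rewrite /clmul scaler_sumr; apply: eq_bigr => A _.
rewrite scaler_sumr; apply: eq_bigr => B _.
by rewrite scalerA !ffunE /GRing.scale/= !mulrA [_ * k]mulrC.
Qed.

Lemma clmulZr (k : R) a b : clmul a (k *: b) = k *: clmul a b.
Proof.
rewrite /clmul scaler_sumr; apply: eq_bigr => A _.
rewrite scaler_sumr; apply: eq_bigr => B _.
by rewrite scalerA !ffunE /GRing.scale/= mulrCA mulrA.
Qed.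

Lemma clmul_basis A B :
  clmul (clbasis A) (clbasis B) =
  (-1) ^+ clsign A B *: clbasis (symdiff A B).
Proof.
rewrite /clmul (bigD1 A)//= (bigD1 B)//= !ffunE !eqxx !mulr1.
rewrite big1 ?addr0 => [|C /negPf CB]; last by rewrite !ffunE CB mulr0 scale0r.
rewrite big1 ?addr0// => C /negPf CA; rewrite big1// => D _.
by rewrite !ffunE CA mulr0 mul0r scale0r.
Qed.

Lemma clmul0l a : clmul 0 a = 0.
Proof. by rewrite -(scale0r a) clmulZl !scale0r. Qed.

Lemma clmul0r a : clmul a 0 = 0.
Proof. by rewrite -(scale0r a) clmulZr !scale0r. Qed.

Lemma clmul_suml (I : Type) (r : seq I) (P : pred I) (F : I -> clifford R n) b :
  clmul (\sum_(i <- r | P i) F i) b = \sum_(i <- r | P i) clmul (F i) b.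
Proof.
by apply: (big_morph (clmul^~ b)) => [? ?|]; rewrite (clmulDl, clmul0l).
Qed.

Lemma clmul_sumr (I : Type) (r : seq I) (P : pred I) (F : I -> clifford R n) a :
  clmul a (\sum_(i <- r | P i) F i) = \sum_(i <- r | P i) clmul a (F i).
Proof.
by apply: (big_morph (clmul a)) => [? ?|]; rewrite (clmulDr, clmul0r).
Qed.

Lemma clmulEl a b : clmul a b = \sum_A a A *: clmul (clbasis A) b.
Proof.
rewrite [in LHS](clbasisE a) clmul_suml.
by apply: eq_bigr => A _; rewrite clmulZl.
Qed.

Lemma clmulEr a b : clmul a b = \sum_B b B *: clmul a (clbasis B).
Proof.
rewrite [in LHS](clbasisE b) clmul_sumr.
by apply: eq_bigr => B _; rewrite clmulZr.
Qed.

Lemma clmulA : associative clmul.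
Proof.
move=> a b c; rewrite (clmulEl a (clmul b c)) (clmulEl a b) [RHS]clmul_suml.
apply: eq_bigr => A _; rewrite [RHS]clmulZl; congr (_ *: _).
rewrite (clmulEl b c) (clmulEr _ b) [RHS]clmul_suml [LHS]clmul_sumr.
apply: eq_bigr => B _; rewrite [RHS]clmulZl [LHS]clmulZr; congr (_ *: _).
rewrite (clmulEr (clbasis B) c) (clmulEr _ c) [LHS]clmul_sumr.
apply: eq_bigr => C _; rewrite [LHS]clmulZr; congr (_ *: _).
rewrite !clmul_basis clmulZl clmulZr !clmul_basis !scalerA -!signr_addb.
rewrite symdiffA clsignDl clsignDr; congr ((-1) ^+ nat_of_bool _ *: _).
by case: (clsign A B) (clsign A C) (clsign B C) => [] [] [].
Qed.

Lemma clmul1l : left_id clid clmul.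
Proof.
move=> a; rewrite [in LHS](clbasisE a) clmul_sumr [RHS]clbasisE.
apply: eq_bigr => A _.
by rewrite clmulZr clmul_basis clsign0s symdiff0s scale1r.
Qed.

Lemma clmul1r : right_id clid clmul.
Proof.
move=> a; rewrite [in LHS](clbasisE a) clmul_suml [RHS]clbasisE.
apply: eq_bigr => A _.
by rewrite clmulZl clmul_basis clsigns0 symdiffs0 scale1r.
Qed.

Lemma clid_neq0 : clid != 0.
Proof.
by apply/eqP => /ffunP/(_ finset.set0)/eqP; rewrite !ffunE eqxx oner_eq0.
Qed.

HB.instance Definition _ := GRing.Zmodule_isNzRing.Build (clifford R n)
  clmulA clmul1l clmul1r clmulDl clmulDr clid_neq0.

HB.instance Definition _ := GRing.Lmodule_isLalgebra.Build R (clifford R n)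
  (fun k a b => esym (clmulZl k a b)).

HB.instance Definition _ := GRing.Lalgebra_isAlgebra.Build R (clifford R n)
  (fun k a b => esym (clmulZr k a b)).

Definition clgen (i : 'I_n) : clifford R n := clbasis [set i]%SET.

Lemma clgen_sqr i : clgen i * clgen i = -1.
Proof.
rewrite [LHS]clmul_basis /clsign !big_set1 leqnn expr1 scaleN1r; congr (- clbasis _).
by apply/finset.setP => j; rewrite !inE addbb.
Qed.

Lemma clgen_anticomm i j : i != j -> clgen i * clgen j + clgen j * clgen i = 0.
Proof.
move=> neqij; rewrite [X in X + _]clmul_basis [X in _ + X]clmul_basis.
rewrite /clsign !big_set1.
have -> : symdiff [set j]%SET [set i]%SET = symdiff [set i]%SET [set j]%SET.
  by apply/finset.setP => l; rewrite !inE addbC.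
rewrite -scalerDl; case: (ltngtP i j) neqij => [||/val_inj->]; rewrite ?eqxx//.
  by rewrite subrr scale0r.
by rewrite addNr scale0r.
Qed.

Lemma clbasis_prod A : clbasis A = \prod_(i in A) clgen i.
Proof.
have sorted_prod (s : seq 'I_n) : sorted (relpre val ltn) s ->
    \prod_(i <- s) clgen i = clbasis [set i in s]%SET.
  have ltn_trans' : transitive (relpre (val : 'I_n -> nat) ltn).
    by move=> ? ? ?; apply: ltn_trans.
  elim: s => [_|x s IHs]; first by rewrite big_nil finset.set_nil.
  rewrite sorted_pairwise//= -sorted_pairwise// => /andP[/allP lt_xs s_sorted].
  rewrite big_cons IHs// [LHS]clmul_basis /clsign big_set1 big1 ?scale1r.
    congr clbasis; apply/finset.setP => i; rewrite !inE.
    by case: eqP => [->|//]; case: (boolP (x \in s)) => // /lt_xs /=; rewrite ltnn.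
  by move=> j; rewrite inE => /lt_xs /= ltxj; rewrite leqNgt ltxj.
rewrite -[RHS]big_filter sorted_prod.
  by congr clbasis; apply/finset.setP => i; rewrite inE mem_filter mem_index_enum andbT.
apply: sorted_filter; first by move=> ? ? ?; apply: ltn_trans.
by rewrite -sorted_map /index_enum unlock -enumT val_enum_ord iota_ltn_sorted.
Qed.

End CliffordAlgebra.

(* Points of R^(n+1) are row vectors x, the coordinate x_0 being x ord0 ord0 and
   x_(l+1) being x ord0 (lift ord0 l), attached to the generator clgen l. *)
Section CliffordAnalysis.
Variables (R : realType) (n : nat).
Implicit Types (x : 'rV[R]_n.+1) (f : 'rV[R]_n.+1 -> clifford R n).

Definition vecpart x : clifford R n :=
  \sum_(l < n) x ord0 (lift ord0 l) *: clgen R l.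

Definition paravector x : clifford R n := (x ord0 ord0)%:A + vecpart x.

Definition paravector_conj x : clifford R n := (x ord0 ord0)%:A - vecpart x.

(* Coordinatewise partial derivative along the j-th axis. *)
Definition cl_partial (j : 'I_n.+1) f x : clifford R n :=
  [ffun A => 'D_(delta_mx ord0 j) (fun y => f y A) x].

Definition dbar f x : clifford R n :=
  cl_partial ord0 f x - \sum_(l < n) clgen R l * cl_partial (lift ord0 l) f x.

Definition pochhammer (a : R) (s : nat) : R := \prod_(i < s) (a + i%:R).

Definition appell_coef (s k : nat) : R :=
  'C(k, s)%:R *
  (pochhammer ((n%:R + 1) / 2) (k - s) * pochhammer ((n%:R - 1) / 2) s
   / pochhammer n%:R k).

Definition clifford_appell (k : nat) x : clifford R n :=
  \sum_(s < k.+1)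
    appell_coef s k *: (paravector x ^+ (k - s) * paravector_conj x ^+ s).

Definition appell_monomial (k s : nat) x : clifford R n :=
  (x ord0 ord0) ^+ k *: clifford_appell s x.

End CliffordAnalysis.

(* Main.v *)
From HB Require Import structures.
Require Import Defs.
From mathcomp Require Import all_boot all_order all_algebra.
From mathcomp Require Import all_classical all_reals all_analysis.
From mathcomp Require Import ring.

(* Write x = t + v with v the vector part. The derivation d/dt sends both x and
   its conjugate to 1, and a Pascal-type relation between the T_s^k gives
   d/dt P_k = k P_(k-1). In the other directions t is a constant, so P_k is a
   polynomial p(v) with real coefficients, and the Dirac operator
   D = \sum_l e_l d/dx_l satisfies
     - 2 v D(p(v)) = 2 v p'(v) + (n - 1) (p(v) - p(-v)).
   Replacing v by -v swaps u = t + v and w = t - v; since 2 v = u - w, the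
   claim - D P_k = k P_(k-1) becomes an identity of real polynomials that
   compares T_s^k, T_(s+1)^k and T_(k-s)^k, and working with polynomials lets
   one cancel 2 v even where v vanishes. *)

Import GRing.Theory Num.Theory numFieldNormedType.Exports.
Set Implicit Arguments.
Unset Strict Implicit.
Unset Printing Implicit Defensive.

Local Open Scope ring_scope.

(** * Recurrences for the Appell coefficients *)

Section Coefficients.
Variables (R : realType) (n : nat).
Hypothesis n_gt0 : (0 < n)%N.

Lemma pochhammer0 (a : R) : pochhammer a 0 = 1.
Proof. by rewrite /pochhammer big_ord0. Qed.

Lemma pochhammerSr (a : R) s : pochhammer a s.+1 = pochhammer a s * (a + s%:R).
Proof. by rewrite /pochhammer big_ord_recr. Qed.

Lemma pochhammerSl (a : R) s : pochhammer a s.+1 = a * pochhammer (a + 1) s.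
Proof.
rewrite /pochhammer big_ord_recl addr0; congr (_ * _).
by apply: eq_bigr => i _; rewrite /= -addrA -natr1 [1 + _]addrC.
Qed.

Lemma pochhammer_nat_neq0 s : pochhammer (n%:R : R) s != 0.
Proof.
rewrite /pochhammer; apply/prodf_neq0 => i _.
by rewrite -natrD pnatr_eq0 -lt0n addn_gt0 n_gt0.
Qed.

Lemma appell_coef_small s k : (k < s)%N -> appell_coef R n s k = 0.
Proof. by move=> lt_ks; rewrite /appell_coef bin_small// mul0r. Qed.

(** Both integer-times-binomial products equal [k.+1 * 'C(k, s)]. What remains is [((n+1)/2 + k - s)
    + ((n-1)/2 + s) = n + k], the last factor of [pochhammer n k.+1]. *)
Lemma appell_coef_pascal s k : (s <= k)%N ->
  (k.+1 - s)%:R * appell_coef R n s k.+1 + s.+1%:R * appell_coef R n s.+1 k.+1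
  = k.+1%:R * appell_coef R n s k.
Proof.
move=> le_sk; rewrite /appell_coef !mulrA -!natrM.
rewrite -(mul_bin_down k.+1 s) -(mul_bin_diag k.+1 s) /= subSn// subSS.
rewrite !pochhammerSr -!mulrA -mulrDr; congr (_ * _).
have nk0 := pochhammer_nat_neq0 k.
have nSk0 : n%:R + k%:R != 0 :> R.
  by rewrite -natrD pnatr_eq0 -lt0n addn_gt0 n_gt0.
by rewrite natrB//; field; rewrite nk0 nSk0.
Qed.

(** With [b = (n - 1) / 2] the two Pochhammer bases are [b + 1] and [b], and [pochb] trades one for
    the other. *)
Lemma appell_coef_swap s k : (s <= k)%N ->
  2 * (s.+1%:R * appell_coef R n s.+1 k) =
  2 * (s%:R * appell_coef R n s k)
  + (n%:R - 1) * (appell_coef R n s k - appell_coef R n (k - s) k).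
Proof.
move=> le_sk; rewrite /appell_coef bin_sub// subKn//.
rewrite [s.+1%:R * _]mulrA -natrM mul_bin_left natrM.
set b : R := (n%:R - 1) / 2.
have -> : (n%:R + 1) / 2 = b + 1 :> R by rewrite /b; field.
have -> : n%:R - 1 = 2 * b :> R by rewrite /b; field.
set N := pochhammer _ k; set C := 'C(k, s)%:R.
have pochb i : b * pochhammer (b + 1) i = pochhammer b i * (b + i%:R).
  by rewrite -pochhammerSl pochhammerSr.
rewrite subnS; case: (k - s)%N => [|e] /=.
  rewrite !pochhammer0 !mul0r mulr0.
  transitivity (2 * C / N * (pochhammer b s * (b + s%:R)
    - b * pochhammer (b + 1) s)); last by ring.
  by rewrite pochb subrr mulr0.
rewrite (pochhammerSl b s) (pochhammerSl b e) (pochhammerSr (b + 1) e) -natr1.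
transitivity (2 * C / N * pochhammer (b + 1) e * (pochhammer b s * (b + s%:R)
  * (b + 1 + e%:R) - b * (b * pochhammer (b + 1) s))); last by ring.
by rewrite -pochb; ring.
Qed.

End Coefficients.

(** * Two-variable Appell sums and the Dirac operator on polynomials in [v] *)

Section AppellForm.
Variables (R : realType) (n : nat).
Hypothesis n_gt0 : (0 < n)%N.

(** The algebra is left free so that one formula serves both a paravector with its conjugate and the
    polynomials [c%:P + 'X] and [c%:P - 'X]. *)
Definition appell_form (A : algType R) (k : nat) (u w : A) : A :=
  \sum_(s < k.+1) appell_coef R n s k *: (u ^+ (k - s) * w ^+ s).

(** The right-hand side is the derivative of the form when [u] and [w] have derivative 1. Its first
    part at [s] and second part at [s + 1] share a monomial, and [appell_coef_pascal] adds them. *)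
Lemma appell_form_pred (A : algType R) k (u w : A) :
  k%:R *: appell_form k.-1 u w =
  \sum_(s < k.+1) appell_coef R n s k *:
    ((k - s)%:R *: (u ^+ (k - s).-1 * w ^+ s)
     + s%:R *: (u ^+ (k - s) * w ^+ s.-1)).
Proof.
case: k => [|k]; first by rewrite big_ord1 /= !scale0r addr0 scaler0.
under eq_bigr do rewrite scalerDr !scalerA.
rewrite big_split /= big_ord_recr /= subnn mulr0 scale0r addr0.
rewrite [X in _ + X]big_ord_recl /= mulr0 scale0r add0r -big_split /=.
rewrite scaler_sumr; apply: eq_bigr => s _.
have le_sk : (s <= k)%N by rewrite -ltnS.
rewrite /bump /= add1n subSS subSn//= -scalerDl scalerA.
by rewrite -appell_coef_pascal// subSn// [_ * appell_coef _ _ s _]mulrC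
  [_ * appell_coef _ _ s.+1 _]mulrC.
Qed.

(** Multiplying by [u] lowers the index of a monomial by one and multiplying by [w] restores it, so
    the coefficients become the differences [c s.+1 - c s], which [appell_coef_swap] evaluates. *)
Lemma appell_form_swap (A : comAlgType R) k (u w : A) :
  \sum_(s < k.+1) (2 * (s%:R * appell_coef R n s k)) *:
    ((u - w) * (u ^+ (k - s) * w ^+ s.-1)) =
  (n%:R - 1) *: (appell_form k u w - appell_form k w u).
Proof.
pose c s : R := 2 * (s%:R * appell_coef R n s k).
have shift : \sum_(s < k.+1) c s *: (u * (u ^+ (k - s) * w ^+ s.-1)) =
    \sum_(s < k.+1) c s.+1 *: (u ^+ (k - s) * w ^+ s).
  (* Both end terms vanish: [c 0] by its factor [s], [c k.+1] by its binomial. *)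
  rewrite big_ord_recl [RHS]big_ord_recr /= {1}/c mul0r mulr0 scale0r add0r.
  rewrite [in RHS]/c appell_coef_small// !mulr0 scale0r addr0.
  by apply: eq_bigr => s _; rewrite /bump /= add1n mulrA -exprS subnSK.
have -> : appell_form k w u =
    \sum_(s < k.+1) appell_coef R n (k - s) k *: (u ^+ (k - s) * w ^+ s).
  rewrite [LHS](reindex_inj rev_ord_inj) /=; apply: eq_bigr => s _.
  by rewrite subSS subKn -1?ltnS// [w ^+ _ * _]mulrC.
rewrite -sumrB scaler_sumr.
transitivity (\sum_(s < k.+1) (c s.+1 - c s) *: (u ^+ (k - s) * w ^+ s)).
  under [RHS]eq_bigr do rewrite scalerBl.
  rewrite sumrB -shift -sumrB; apply: eq_bigr => s _.
  rewrite mulrBl scalerBr; congr (_ - _); case: (nat_of_ord s) => [|i] /=.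
    by rewrite /c mul0r mulr0 !scale0r.
  by rewrite [w * _]mulrCA -exprS.
apply: eq_bigr => s _; rewrite -scalerBl scalerA; congr (_ *: _).
by rewrite /c appell_coef_swap -1?ltnS// addrC addKr.
Qed.

(* [\sum_l e_l d/dx_l] maps [v ^+ j] to [- dirac_eigen j *: v ^+ j.-1], where [v]
   is the vector part; [radial_dirac] is the negated action on polynomials in
   [v] with real coefficients. *)
Definition dirac_eigen (j : nat) : R := j%:R + (odd j)%:R * (n%:R - 1).

Definition radial_dirac (p : {poly R}) : {poly R} :=
  \sum_(i < size p) (p`_i * dirac_eigen i) *: 'X^(i.-1).

(** On ['X^i] the difference with the reflected polynomial is [2 'X^i] for odd [i] and 0 for even
    [i], matching the parity term of [dirac_eigen]. *)
Lemma radial_diracE (p : {poly R}) :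
  ('X * radial_dirac p) *+ 2 =
  ('X * p^`()) *+ 2 + (n%:R - 1) *: (p - (p \Po (- 'X))).
Proof.
rewrite -[in RHS](coefK p) poly_def /radial_dirac.
rewrite raddf_sum /= [_ \Po _]raddf_sum /= -sumrB scaler_sumr !mulr_sumr.
rewrite -!sumrMnl -big_split /=; apply: eq_bigr => i _.
rewrite derivZ derivXn comp_polyZ comp_Xn_poly exprNn -signr_odd /dirac_eigen.
rewrite -!mul_polyC; move: (n%:R - 1) => d.
case: (nat_of_ord i) => [|j] /=; first by rewrite !mul0r addr0 mulr0; ring.
rewrite exprS polyCM polyCD polyCM !polyC_natr -['X^j *+ _]mulr_natr.
by case: (odd j); rewrite /= ?expr1 ?expr0; ring.
Qed.

Lemma horner_algZ (A : algType R) (a : A) c (p : {poly R}) :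
  horner_alg a (c *: p) = c *: horner_alg a p.
Proof. by rewrite -mul_polyC rmorphM /= horner_algC mulr_algl. Qed.

Lemma horner_alg_form (A : algType R) k (a : A) (u w : {poly R}) :
  horner_alg a (appell_form k u w) =
  appell_form k (horner_alg a u) (horner_alg a w).
Proof.
rewrite raddf_sum; apply: eq_bigr => s _.
by rewrite /= horner_algZ rmorphM !rmorphXn.
Qed.

Lemma radial_dirac_form k (c : R) :
  radial_dirac (appell_form k (c%:P + 'X) (c%:P - 'X)) =
  k%:R *: appell_form k.-1 (c%:P + 'X) (c%:P - 'X).
Proof.
set u := c%:P + 'X; set w := c%:P - 'X.
have uw : 'X *+ 2 = u - w by rewrite /u /w; ring.
have X2_neq0 : 'X *+ 2 != 0 :> {poly R}.
  by rewrite -scaler_nat scaler_eq0 polyX_eq0 pnatr_eq0.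
apply: (mulfI X2_neq0); rewrite mulrnAl radial_diracE -mulrnAl uw.
have -> : appell_form k u w \Po (- 'X) = appell_form k w u.
  rewrite raddf_sum; apply: eq_bigr => s _ /=.
  rewrite comp_polyZ comp_polyM !rmorphXn /=.
  by rewrite /u /w !raddfD /= raddfN /= comp_polyC comp_polyX opprK.
(* Since [w] has derivative -1, the terms with factor [s] enter with the wrong sign; the swap
   identity adds them twice, which yields the summands of [appell_form_pred]. *)
rewrite -appell_form_swap appell_form_pred raddf_sum !mulr_sumr -big_split /=.
have du : u^`() = 1 by rewrite /u derivD derivC derivX add0r.
have dw : w^`() = -1 by rewrite /w derivB derivC derivX sub0r.
apply: eq_bigr => s _; rewrite derivZ derivM !deriv_exp du dw.
rewrite -!mul_polyC; move: (appell_coef _ _ _ _) => t.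
rewrite !polyCM !polyC_natr; by ring.
Qed.

End AppellForm.

(** * Coordinatewise differential calculus in the Clifford algebra *)

Section ComponentwiseDerivative.
Variables (R : realType) (n : nat).
Implicit Types (x v : 'rV[R]_n.+1) (f g : 'rV[R]_n.+1 -> clifford R n).

(** This later allows [x ord0 ord0] to be frozen when differentiating along the other axes. *)
Lemma derive_eq_line (V W : normedModType R) (f g : V -> W) (x v : V) :
  (forall h : R, f (h *: v + x) = g (h *: v + x)) -> 'D_v f x = 'D_v g x.
Proof.
move=> fg; have fgx : f x = g x by have := fg 0; rewrite scale0r add0r.
rewrite /derive fgx.
have -> // : (fun h : R => h^-1 *: ((f \o shift x) (h *: v) - g x)) =
  (fun h : R => h^-1 *: ((g \o shift x) (h *: v) - g x)).
by apply/funext => h /=; rewrite fg.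
Qed.

Lemma is_derive_coord x v (i : 'I_n.+1) :
  is_derive x v (fun y : 'rV[R]_n.+1 => y ord0 i) (v ord0 i).
Proof.
have lin : linear (fun y : 'rV[R]_n.+1 => y ord0 i : R^o).
  by move=> a y z; rewrite !mxE.
pose L := GRing.isLinear.Build _ _ _ _ _ lin.
pose F : {linear 'rV[R]_n.+1 -> R^o} :=
  HB.pack (fun y : 'rV[R]_n.+1 => y ord0 i : R^o) L.
have cF : continuous F by move=> y; exact: coord_continuous.
apply: DeriveDef; first exact/diff_derivable/differentiable_coord.
rewrite deriveE; last exact: differentiable_coord.
by rewrite (diff_lin x cF).
Qed.

Definition is_clderive v f x (d : clifford R n) :=
  forall A, is_derive x v (fun y => f y A) (d A).

Lemma is_clderive_cst v x c : is_clderive v (fun=> c) x 0.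
Proof. by move=> A; rewrite ffunE; exact: is_derive_cst. Qed.

Lemma is_clderiveD v f g x df dg :
  is_clderive v f x df -> is_clderive v g x dg ->
  is_clderive v (fun y => f y + g y) x (df + dg).
Proof.
move=> hf hg A; rewrite ffunE.
by under eq_fun do rewrite ffunE; exact: is_deriveD.
Qed.

Lemma is_clderive_scale v (a : 'rV[R]_n.+1 -> R) f x da df :
  is_derive x v a da -> is_clderive v f x df ->
  is_clderive v (fun y => a y *: f y) x (a x *: df + da *: f x).
Proof.
move=> ha hf A; rewrite !ffunE [da *: _]mulrC.
by under eq_fun do rewrite ffunE; exact: (is_deriveM ha (hf A)).
Qed.

Lemma is_clderiveZ v (c : R) f x df :
  is_clderive v f x df -> is_clderive v (fun y => c *: f y) x (c *: df).
Proof.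
move=> hf; have := is_clderive_scale (is_derive_cst c x v) hf.
by rewrite scale0r addr0.
Qed.

Lemma is_clderive_sum v (I : Type) (r : seq I) (P : pred I)
    (F : I -> 'rV[R]_n.+1 -> clifford R n) x (dF : I -> clifford R n) :
  (forall i, is_clderive v (F i) x (dF i)) ->
  is_clderive v (fun y => \sum_(i <- r | P i) F i y) x
    (\sum_(i <- r | P i) dF i).
Proof.
move=> hF; elim: r => [|i r IHr].
  by rewrite big_nil; under eq_fun do rewrite big_nil; exact: is_clderive_cst.
rewrite big_cons; under eq_fun do rewrite big_cons.
by case: ifP => // _; exact: is_clderiveD.
Qed.

Lemma is_clderiveM v f g x df dg :
  is_clderive v f x df -> is_clderive v g x dg ->
  is_clderive v (fun y => f y * g y) x (f x * dg + df * g x).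
Proof.
move=> hf hg.
(* With the constants [e A B] a product is bilinear in real coordinates, so the real product rule
   applies term by term. *)
pose e (A B : {set 'I_n}) : clifford R n := clbasis R A * clbasis R B.
have mulE (a b : clifford R n) :
    a * b = \sum_A \sum_B (a A * b B) *: e A B.
  rewrite [LHS](clmulEl a); apply: eq_bigr => A _.
  rewrite clmulEr scaler_sumr; apply: eq_bigr => B _.
  by rewrite scalerA.
under eq_fun do rewrite mulE.
rewrite !mulE -big_split; apply: is_clderive_sum => A /=.
rewrite -big_split; apply: is_clderive_sum => B /=.
rewrite -scalerDl [df A * _]mulrC.
have := is_clderive_scale (is_deriveM (hf A) (hg B))
  (is_clderive_cst v x (e A B)).
by rewrite scaler0 add0r.
Qed.

Lemma is_clderive_partial j f x d :
  is_clderive (delta_mx ord0 j) f x d -> cl_partial j f x = d.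
Proof. by move=> hf; apply/ffunP => A; rewrite ffunE; exact: derive_val. Qed.

Lemma cl_partial_eq_line j f g x :
  (forall h : R, f (h *: delta_mx ord0 j + x) = g (h *: delta_mx ord0 j + x)) ->
  cl_partial j f x = cl_partial j g x.
Proof.
by move=> fg; apply/ffunP => A; rewrite !ffunE; apply: derive_eq_line => h;
  rewrite fg.
Qed.

End ComponentwiseDerivative.

(** * The Dirac operator on powers of the vector part, and the final computation *)

Section Dirac.
Variables (R : realType) (n : nat).
Implicit Types x : 'rV[R]_n.+1.
Local Notation e := (@clgen R n).
Local Notation axis j := (delta_mx ord0 j : 'rV[R]_n.+1).

Lemma clgen_vecpart_anticomm x (l : 'I_n) :
  e l * vecpart x + vecpart x * e l = - ((2 * x ord0 (lift ord0 l)) *: 1).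
Proof.
rewrite /vecpart mulr_sumr mulr_suml -big_split /= (bigD1 l)//= big1 => [|m ml].
  rewrite -scalerAr -scalerAl clgen_sqr addr0 -scalerDl -mulr2n.
  by rewrite scalerN mulr_natl.
by rewrite -scalerAr -scalerAl -scalerDr clgen_anticomm 1?eq_sym// scaler0.
Qed.

Lemma is_clderive_vecpart x (j : 'I_n.+1) :
  is_clderive (axis j) (@vecpart R n) x
    (\sum_(l < n) (lift ord0 l == j)%:R *: e l).
Proof.
apply: is_clderive_sum => l.
have := is_clderive_scale (is_derive_coord x (axis j) (lift ord0 l))
  (is_clderive_cst (axis j) x (e l)).
by rewrite scaler0 add0r mxE eqxx /=.
Qed.

Lemma is_clderive_vecpart0 x : is_clderive (axis ord0) (@vecpart R n) x 0.
Proof.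
have := is_clderive_vecpart x ord0.
by rewrite big1 // => l _; rewrite eq_sym (negPf (neq_lift _ _)) scale0r.
Qed.

Lemma is_clderive_vecpart_lift x (l : 'I_n) :
  is_clderive (axis (lift ord0 l)) (@vecpart R n) x (e l).
Proof.
have := is_clderive_vecpart x (lift ord0 l).
rewrite (bigD1 l)//= eqxx scale1r big1 ?addr0// => m /negPf ml.
by rewrite (inj_eq lift_inj) ml scale0r.
Qed.

(** The witness [w] keeps the individual partial derivatives, which the product rule in
    [has_dirac_exp] needs. *)
Definition has_dirac (f : 'rV[R]_n.+1 -> clifford R n) x (d : clifford R n) :=
  exists2 w : 'I_n -> clifford R n,
    forall l, is_clderive (axis (lift ord0 l)) f x (w l) &
    \sum_(l < n) e l * w l = d.

(* Splitting off [v ^+ 2] keeps noncommutativity harmless, since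
   [e l * v + v * e l] is a scalar. *)
Lemma has_dirac_exp x j :
  has_dirac (fun y => vecpart y ^+ j) x
    (- (dirac_eigen R n j *: vecpart x ^+ j.-1)).
Proof.
pose P i := has_dirac (fun y => vecpart y ^+ i) x
  (- (dirac_eigen R n i *: vecpart x ^+ i.-1)).
(* Going from [j] to [j + 2] preserves the parity on which the eigenvalue depends. *)
suff [] : P j /\ P j.+1 by []; rewrite {}/P.
elim: j => [|j [[w hw sw] IHj1]]; split => //.
- exists (fun=> 0) => [l|]; first exact: is_clderive_cst.
  by rewrite big1 ?/dirac_eigen ?mul0r ?addr0 ?scale0r ?oppr0// => l; rewrite mulr0.
- exists e; first exact: is_clderive_vecpart_lift.
  under eq_bigr do rewrite clgen_sqr.
  by rewrite sumr_const card_ord /dirac_eigen /= mul1r subrKC mulNrn scaler_nat.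
set v := vecpart x in sw *.
exists (fun l => v ^+ j * (v * e l + e l * v) + w l * (v * v)) => [l|].
  under eq_fun do rewrite -addn2 exprD expr2.
  have hv := is_clderive_vecpart_lift x l.
  exact: is_clderiveM (hw l) (is_clderiveM hv hv).
have vj : v * v ^+ j = \sum_(l < n) x ord0 (lift ord0 l) *: (e l * v ^+ j).
  by rewrite {1}/v /vecpart mulr_suml; apply: eq_bigr => l _; rewrite scalerAl.
have ve l : e l * v + v * e l = - ((2 * x ord0 (lift ord0 l)) *: 1).
  exact: clgen_vecpart_anticomm.
clearbody v.
(* Each [v * e l + e l * v] is the scalar [-2 x_l], and weighting [e l * v ^+ j] by these rebuilds
   [-2 v * v ^+ j]. *)
transitivity ((\sum_(l < n) e l * w l) * (v * v) - 2 *: (v * v ^+ j)).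
  rewrite vj mulr_suml scaler_sumr -sumrB; apply: eq_bigr => l _.
  rewrite [v * e l + _]addrC ve mulrDr addrC mulrA; congr (_ + _).
  by rewrite mulrN mulrN -!scalerAr mulr1 scalerA.
rewrite sw mulNr -opprD -scalerAl -exprS; congr (- _).
have -> : dirac_eigen R n j.+2 = dirac_eigen R n j + 2.
  by rewrite /dirac_eigen [odd j.+2]/= negbK -addn2 natrD addrAC.
rewrite [RHS]scalerDl; suff -> : dirac_eigen R n j *: (v ^+ j.-1 * (v * v)) =
  dirac_eigen R n j *: v ^+ j.+1 by [].
(* At [j = 0] the truncated predecessor is harmless because the eigenvalue is 0. *)
case: {+}j => [|i]; first by rewrite /dirac_eigen mul0r addr0 !scale0r.
by rewrite /= mulrA -!exprSr.
Qed.

Lemma horner_algE (a : clifford R n) (p : {poly R}) :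
  horner_alg a p = \sum_(i < size p) p`_i *: a ^+ i.
Proof.
rewrite -[in LHS](coefK p) poly_def raddf_sum; apply: eq_bigr => i _ /=.
by rewrite horner_algZ rmorphXn /= horner_algX.
Qed.

Lemma has_dirac_horner x (p : {poly R}) :
  has_dirac (fun y => horner_alg (vecpart y) p) x
    (- horner_alg (vecpart x) (radial_dirac n p)).
Proof.
have /choice[w hw] j : exists w : 'I_n -> clifford R n,
    (forall l, is_clderive (axis (lift ord0 l)) (fun y => vecpart y ^+ j) x (w l)) /\
    \sum_(l < n) e l * w l = - (dirac_eigen R n j *: vecpart x ^+ j.-1).
  by have [w] := has_dirac_exp x j; exists w.
exists (fun l => \sum_(i < size p) p`_i *: w i l) => [l|].
  under eq_fun do rewrite horner_algE.
  by apply: is_clderive_sum => i; apply: is_clderiveZ; exact: (hw i).1.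
under eq_bigr do rewrite mulr_sumr.
rewrite exchange_big raddf_sum -sumrN /=; apply: eq_bigr => i _.
under eq_bigr do rewrite -scalerAr.
rewrite -scaler_sumr (hw i).2 scalerN scalerA; congr (- _).
by rewrite horner_algZ rmorphXn /= horner_algX.
Qed.

(** A derivative equal to 1 commutes with the powers of [f x], so the usual power rule survives. *)
Lemma is_clderive_exp v (f : 'rV[R]_n.+1 -> clifford R n) x m :
  is_clderive v f x 1 ->
  is_clderive v (fun y => f y ^+ m) x (m%:R *: f x ^+ m.-1).
Proof.
move=> hf; elim: m => [|m IHm]; first by rewrite scale0r; exact: is_clderive_cst.
under eq_fun do rewrite exprS.
have -> : m.+1%:R *: f x ^+ m = f x * (m%:R *: f x ^+ m.-1) + 1 * f x ^+ m.
  rewrite mul1r -scalerAr -natr1 scalerDl scale1r; congr (_ + _).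
  by case: m {IHm} => [|m]; rewrite ?scale0r// -exprS.
exact: is_clderiveM.
Qed.

Lemma is_clderive_appell_form (n_gt0 : (0 < n)%N) v
    (f g : 'rV[R]_n.+1 -> clifford R n) x k :
  is_clderive v f x 1 -> is_clderive v g x 1 ->
  is_clderive v (fun y => appell_form n k (f y) (g y)) x
    (k%:R *: appell_form n k.-1 (f x) (g x)).
Proof.
move=> hf hg; rewrite appell_form_pred//.
apply: is_clderive_sum => s; apply: is_clderiveZ.
rewrite addrC scalerAr scalerAl.
by apply: is_clderiveM; exact: is_clderive_exp.
Qed.

Lemma is_clderive_paravector0 x : is_clderive (axis ord0) (@paravector R n) x 1.
Proof.
have h := is_clderive_scale (is_derive_coord x (axis ord0) ord0)
  (is_clderive_cst (axis ord0) x 1).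
have := is_clderiveD h (is_clderive_vecpart0 x).
by rewrite mxE !eqxx scaler0 add0r scale1r addr0.
Qed.

Lemma is_clderive_paravector_conj0 x :
  is_clderive (axis ord0) (@paravector_conj R n) x 1.
Proof.
have h := is_clderive_scale (is_derive_coord x (axis ord0) ord0)
  (is_clderive_cst (axis ord0) x 1).
have := is_clderiveD h (is_clderiveZ (-1) (is_clderive_vecpart0 x)).
rewrite mxE !eqxx !scaler0 add0r scale1r addr0.
by under eq_fun do rewrite scaleN1r.
Qed.

Lemma has_diracZ c f x d :
  has_dirac f x d -> has_dirac (fun y => c *: f y) x (c *: d).
Proof.
move=> [w hw <-]; exists (fun l => c *: w l) => [l|].
  exact: is_clderiveZ.
by rewrite scaler_sumr; apply: eq_bigr => l _; rewrite scalerAr.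
Qed.

Lemma has_dirac_partial f x d : has_dirac f x d ->
  \sum_(l < n) e l * cl_partial (lift ord0 l) f x = d.
Proof.
move=> [w hw <-]; apply: eq_bigr => l _.
by rewrite (is_clderive_partial (hw l)).
Qed.

(** The polynomial depends on [x] only through [x ord0 ord0]; once this is frozen,
    [has_dirac_horner] applies. *)
Lemma horner_alg_clifford_appell k x :
  clifford_appell k x = horner_alg (vecpart x)
    (appell_form n k ((x ord0 ord0)%:P + 'X) ((x ord0 ord0)%:P - 'X)).
Proof.
by rewrite horner_alg_form raddfD raddfB /= horner_algC horner_algX.
Qed.

(** The factor [2 * s] has two halves, one from the [x_0] derivative of the Appell polynomial and
    one from minus its Dirac derivative. *)
Lemma dbar_appell_monomial (n_gt0 : (0 < n)%N) k s x :
  dbar (@appell_monomial R n k s) x =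
  k%:R *: appell_monomial k.-1 s x + (2 * s%:R) *: appell_monomial k s.-1 x.
Proof.
set x0 := x ord0 ord0.
pose p i := appell_form n i (x0%:P + 'X) (x0%:P - 'X).
have frozen :
    \sum_(l < n) e l * cl_partial (lift ord0 l) (@appell_monomial R n k s) x =
    \sum_(l < n) e l * cl_partial (lift ord0 l)
      (fun y => x0 ^+ k *: horner_alg (vecpart y) (p s)) x.
  apply: eq_bigr => l _; congr (_ * _); apply: cl_partial_eq_line => h.
  rewrite /appell_monomial horner_alg_clifford_appell.
  suff -> : (h *: axis (lift ord0 l) + x) ord0 ord0 = x0 by [].
  by rewrite !mxE /= mulr0 add0r.
rewrite /dbar frozen (has_dirac_partial (has_diracZ _ (has_dirac_horner _ _))).
rewrite scalerN opprK.
have hx0 : is_derive x (axis ord0) (fun y => y ord0 ord0 ^+ k) (k%:R * x0 ^+ k.-1).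
  have := is_deriveX k (is_derive_coord x (axis ord0) ord0).
  by rewrite exprfctE mxE !eqxx [_ *: _]mulr1.
have := is_clderive_scale hx0 (is_clderive_appell_form n_gt0 s
  (is_clderive_paravector0 x) (is_clderive_paravector_conj0 x)).
move=> /is_clderive_partial ->.
rewrite radial_dirac_form// horner_algZ -horner_alg_clifford_appell.
have c2 : 2 * s%:R * x0 ^+ k = x0 ^+ k * s%:R + x0 ^+ k * s%:R by ring.
by rewrite /appell_monomial !scalerA addrAC -[X in X + _ = _]scalerDl -c2 addrC.
Qed.

End Dirac.

Theorem proposition7p11 (R : realType) (n : nat) (n_odd : odd n)
    (m k s : nat) (le_km : (k <= m)%N) (x : 'rV[R]_n.+1) :
  dbar (@appell_monomial R n k s) x =
  k%:R *: appell_monomial k.-1 s x + (2 * s%:R) *: appell_monomial k s.-1 x.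
(* An odd [n] is positive, which keeps the Pochhammer denominators nonzero. *)
Proof. exact: dbar_appell_monomial (odd_gt0 n_odd) _ _ _. Qed.
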